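(* Let $D=(V,A)$ be an acyclic digraph and let $g:V\to[1,|V|]$ be an acyclic ordering of $D$. Then $$\langle e_D,g\rangle\ \geq\ \frac12\,\langle e_D,e_D\rangle,$$ that is, $$\sum_{x\in V} e_D(x)\,g(x)\ \geq\ \frac12\sum_{x\in V} e_D(x)^2 .$$
   Context: A digraph $D=(V,A)$ consists of a nonempty finite set $V$ of vertices and a set $A$ of ordered pairs of distinct vertices, called arcs (so there are no loops and no multiple arcs). $D$ is acyclic if it has no directed cycle. For $x\in V$ put $N^+(x)=\{z\in V:(x,z)\in A\}$, $N^-(x)=\{z\in V:(z,x)\in A\}$ and $e_D(x)=|N^-(x)|-|N^+(x)|$ (an integer). The interval $[1,n]$ denotes $\{1,2,\dots,n\}$. An acyclic ordering of $D$ is a one-to-one map $g:V\to[1,|V|]$ such that for all $x,y\in V$, $(x,y)\in A$ implies $g(x)<g(y)$. For functions $u,v:V\to\mathbb{Z}$, $\langle u,v\rangle=\sum_{x\in V}u(x)v(x)$. *)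

(* Defs.v *)
From mathcomp Require Import all_boot all_order all_algebra.

Set Implicit Arguments.
Unset Strict Implicit.
Unset Printing Implicit Defensive.

Import Order.TTheory GRing.Theory Num.Theory.
Local Open Scope ring_scope.

(* A digraph on the vertex type V is given by its arc
   relation A, where A x y means that (x, y) is an arc. *)
Definition digraph (V : finType) (A : rel V) : Prop :=
  (0 < #|V|)%N /\ irreflexive A.

(* ucycle A c holds for the empty sequence, which is not a directed cycle; one
   of length 1 would be a loop, so in a digraph a nonempty c has length >= 2. *)
Definition acyclic (V : finType) (A : rel V) : Prop :=
  forall c : seq V, ucycle A c -> c = [::].

Definition out_nbr (V : finType) (A : rel V) (x : V) : {set V} :=
  [set z | A x z].

Definition in_nbr (V : finType) (A : rel V) (x : V) : {set V} :=
  [set z | A z x].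

Definition imbalance (V : finType) (A : rel V) (x : V) : int :=
  #|in_nbr A x|%:Z - #|out_nbr A x|%:Z.

Definition acyclic_ordering (V : finType) (A : rel V) (g : V -> nat) : Prop :=
  [/\ injective g,
      forall x, (1 <= g x <= #|V|)%N
    & forall x y, A x y -> (g x < g y)%N].

Definition inner (V : finType) (u v : V -> int) : int := \sum_(x : V) u x * v x.

(* Main.v *)
Require Import Defs.
From mathcomp Require Import all_boot all_order all_algebra.
From mathcomp Require Import zify ring lra.

(** Let [n] be the number of vertices and [e] the imbalance of the digraph [D].
    Write [T] for the transitive tournament that contains an arc from [x] to
    [y] whenever [g x < g y], and [t] for its imbalance. Since [g] enumerates
    [1, n], a vertex has [g x - 1] predecessors and [n - g x] successors in
    [T], so [t x = 2 g x - (n + 1)] (lemma [imbalance_tournament]). Imbalances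
    sum to [0], so the constant drops out and [2 <e, g> = <e, t>]. Hence
      [2 <e, g> - <e, e> = <e, t - e> = <e, f>],
    where [f] is the imbalance of the complement of [D] in [T], and it remains
    to prove [<e, f> >= 0].

    Expanded over pairs of arcs, [<e, f>] is a sum over the pairs that share an
    end [x], one arc in [D] and the other in the complement; such a pair counts
    [+1] when both arcs enter or both leave [x], and [-1] when one enters and
    the other leaves. Group these pairs by the three vertices involved, say
    with [g a < g b < g c], and colour the arcs of [T] according to whether
    they lie in [D]. Only the pair [ab], [bc], at the middle vertex, can count
    [-1], and it does so when [ab] and [bc] have different colours; but then
    [ac] differs in colour from one of them, which yields a [+1] at [a] or at
    [c]. So every triple contributes a nonnegative amount (lemma
    [triple_contribution_ge0]); this is the triangle inequality for the
    discrete metric on two colours. *)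

Import Order.TTheory GRing.Theory Num.Theory.
Local Open Scope ring_scope.

(** The skew-symmetric form of an arc relation: a digraph is traded for a
    matrix whose column sums are the imbalances, which makes imbalances
    additive over arc-disjoint unions. *)
Definition net (V : finType) (A : rel V) (x y : V) : int :=
  (A x y)%:Z - (A y x)%:Z.
Arguments net {V} A x y.

Definition tournament (V : finType) (g : V -> nat) : rel V :=
  fun x y => (g x < g y)%N.
Arguments tournament {V} g x y.

Lemma imbalance_net (V : finType) (A : rel V) (x : V) :
  imbalance A x = \sum_y net A y x.
Proof.
have card_sum (P : pred V) : #|[set y | P y]|%:Z = \sum_y (P y)%:Z.
  by rewrite cardsE -sum1_card big_mkcond (big_morph Posz PoszD (erefl _));
     apply: eq_bigr => y _; rewrite unfold_in; case: (P y).
by rewrite /imbalance /net sumrB !card_sum.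
Qed.

Lemma sum_imbalance (V : finType) (A : rel V) : \sum_x imbalance A x = 0.
Proof.
under eq_bigr do rewrite imbalance_net.
under eq_bigr do rewrite sumrB.
by rewrite sumrB exchange_big subrr.
Qed.

(** Through [g] the count becomes a sum of signs over the integers of
    [1, n], of which [g x - 1] are below [g x] and [n - g x] above. *)
Lemma imbalance_tournament (V : finType) (g : V -> nat) (x : V) :
  injective g -> (forall y, (1 <= g y <= #|V|)%N) ->
  imbalance (tournament g) x = 2 * (g x)%:Z - #|V|.+1%:Z.
Proof.
move=> g_inj g_bnd.
have g_enum : perm_eq [seq g y | y <- enum V] (iota 1 #|V|).
  have g_uniq : uniq [seq g y | y <- enum V] by rewrite map_inj_uniq ?enum_uniq.
  apply: uniq_perm => //; first exact: iota_uniq.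
  have [] // := uniq_min_size g_uniq (s2 := iota 1 #|V|).
    by move=> _ /mapP[y _ ->]; rewrite mem_iota; have := g_bnd y; lia.
  by rewrite size_iota size_map -cardE.
pose sign k i := (i < k)%N%:Z - (k < i)%N%:Z.
have sum_sign n k : (0 < k)%N ->
    \sum_(1 <= i < n.+1) sign k i = if (k <= n)%N then 2 * k%:Z - n.+1%:Z else n%:Z.
  move=> k_gt0; elim: n => [|n IHn]; first by rewrite big_geq //; case: ifP; lia.
  by rewrite big_nat_recr //= IHn /sign; do !case: ifP; lia.
rewrite imbalance_net.
have -> : \sum_y net (tournament g) y x = \sum_(1 <= i < #|V|.+1) sign (g x) i.
  rewrite /index_iota subn1 /= -(perm_big _ g_enum) big_map big_enum /=.
  exact: eq_bigr.
by have /andP[g_gt0 g_le] := g_bnd x; rewrite sum_sign // g_le.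
Qed.

(** A sum over ordered triples may be averaged over the six permutations of
    its indices, so only the total contribution of each triple matters. *)
Lemma sum_triple_ge0 (V : finType) (F : V -> V -> V -> int) :
  (forall x y z, 0 <= F x y z + F x z y + F y x z + F y z x + F z x y + F z y x) ->
  0 <= \sum_x \sum_y \sum_z F x y z.
Proof.
move=> F_ge0; set S := (X in 0 <= X).
have swap23 (G : V -> V -> V -> int) :
    \sum_x \sum_y \sum_z G x z y = \sum_x \sum_y \sum_z G x y z.
  by apply: eq_bigr => x _; rewrite exchange_big.
have swap12 (G : V -> V -> V -> int) :
    \sum_x \sum_y \sum_z G y x z = \sum_x \sum_y \sum_z G x y z.
  by rewrite exchange_big.
have split3 (G H : V -> V -> V -> int) :
    \sum_x \sum_y \sum_z (G x y z + H x y z)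
      = \sum_x \sum_y \sum_z G x y z + \sum_x \sum_y \sum_z H x y z.
  rewrite -big_split; apply: eq_bigr => x _; rewrite -big_split.
  by apply: eq_bigr => y _; rewrite -big_split.
have S6 : S *+ 6 = \sum_x \sum_y \sum_z
    (F x y z + F x z y + F y x z + F y z x + F z x y + F z y x).
  transitivity (S + S + S + S + S + S); first by ring.
  rewrite !split3.
  congr (_ + _ + _ + _ + _ + _).
  - by rewrite swap23.
  - by rewrite swap12.
  - by rewrite (swap12 (fun x y z => F x z y)) swap23.
  - by rewrite (swap23 (fun x y z => F y x z)) swap12.
  - by rewrite (swap23 (fun x y z => F y z x)) (swap12 (fun x y z => F x z y)) swap23.
rewrite -(pmulrn_lge0 S (isT : (0 < 6)%N)) S6.
by do 3!apply: sumr_ge0 => ? _.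
Qed.

(** The six terms correspond to the ways to choose, among the arcs of [T] spanned by
    [x], [y] and [z], one of [D] and one of the complement with a common end.
    Triples with a repeated vertex contribute nothing, since no arc is in both
    digraphs. *)
Lemma triple_contribution_ge0 (V : finType) (A : rel V) (g : V -> nat) :
  injective g -> (forall x y, A x y -> (g x < g y)%N) ->
  let cross x y z := net A y x * (net (tournament g) z x - net A z x) in
  forall x y z, 0 <= cross x y z + cross x z y + cross y x z
                   + cross y z x + cross z x y + cross z y x.
Proof.
move=> g_inj A_lt cross x y z; rewrite /cross /net /tournament {cross}.
have A_ge u v : (g v <= g u)%N -> A u v = false.
  by move=> le_vu; apply/negP => /A_lt; rewrite ltnNge le_vu.
(* Once the order of the vertices is known, [A_ge] settles all backward arcs;
   only the membership in [D] of the forward ones is left to enumerate. *)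
by case: (ltngtP (g x) (g y)) => [xy|xy|/g_inj xy]; try subst y;
   case: (ltngtP (g x) (g z)) => [xz|xz|/g_inj xz]; try subst z;
   try (case: (ltngtP (g y) (g z)) => [yz|yz|/g_inj yz]; try subst z);
   rewrite ?ltnn ?(A_ge _ _ (leqnn _)) ?(A_ge _ _ (ltnW xy))
           ?(A_ge _ _ (ltnW xz)) ?(A_ge _ _ (ltnW yz)) //; try lia;
   do ?case: (A _ _).
Qed.

Theorem theorem1 (V : finType) (A : rel V) (g : V -> nat)
    (hD : digraph A) (hA : acyclic A) (hg : acyclic_ordering A g) :
  (inner (imbalance A) (fun x => (g x)%:Z))%:Q
    >= 1 / 2 * (inner (imbalance A) (imbalance A))%:Q.
Proof.
have [g_inj g_bnd A_lt] := hg.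
suff : inner (imbalance A) (imbalance A)
         <= 2 * inner (imbalance A) (fun x => (g x)%:Z).
  by rewrite -(ler_int rat) rmorphM /=; lra.
have two_inner : 2 * inner (imbalance A) (fun x => (g x)%:Z)
    = inner (imbalance A) (imbalance (tournament g)).
  have constant_drops : \sum_x imbalance A x * #|V|.+1%:Z = 0.
    by rewrite -mulr_suml sum_imbalance mul0r.
  rewrite /inner mulr_sumr -[LHS]subr0 -[X in _ - X]constant_drops -sumrB.
  apply: eq_bigr => x _.
  by rewrite imbalance_tournament //; ring.
rewrite two_inner -subr_ge0 /inner -sumrB.
have -> : \sum_x (imbalance A x * imbalance (tournament g) x
                  - imbalance A x * imbalance A x)
    = \sum_x \sum_y \sum_z net A y x * (net (tournament g) z x - net A z x).
  apply: eq_bigr => x _; rewrite -mulrBr !imbalance_net -sumrB mulr_suml.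
  by apply: eq_bigr => y _; rewrite mulr_sumr.
exact: sum_triple_ge0 (triple_contribution_ge0 V A g g_inj A_lt).
Qed.
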